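(* The theory $MODDAG$ is the model companion of the theory $MODAG$ (both in the language $\mathcal{L}_{\rho\cdot,<}=\{+,-,0,<,\rho\cdot,\rho^{-1}\cdot\}$).
   Context: $\mathcal{L}_{\rho\cdot,<}$ is the language of ordered abelian groups together with unary function symbols $\rho\cdot$ and $\rho^{-1}\cdot$. An ordered difference abelian group is an ordered abelian group in which $\rho\cdot$ and $\rho^{-1}\cdot$ are mutually inverse order-preserving group automorphisms. For $i\in\mathbb N$ write $\rho^i\cdot x$ for the $i$-fold iterate of $\rho\cdot$, and for a ''linear difference operator'' $L=m_k\rho^k+\dots+m_1\rho+m_0\in\mathbb Z[\rho]$ ($m_i\in\mathbb Z$) write $L\cdot x:=m_k\rho^k\cdot x+\dots+m_0x$. $MODAG$ (multiplicative ordered difference abelian groups) is the theory of ordered difference abelian groups satisfying Axiom OM: for each $L\in\mathbb Z[\rho]$, either $L\cdot x>0$ for all $x>0$, or $L\cdot x=0$ for all $x>0$, or $L\cdot x<0$ for all $x>0$. $MODDAG$ is the theory $MODAG$ together with $\exists x\,(x\neq 0)$ and, for each $L\in\mathbb Z[\rho]$, the axiom $\big(\forall\gamma\,(L\cdot\gamma=0)\big)\vee\big(\forall\gamma\,\exists\delta\,(L\cdot\delta=\gamma)\big)$. *)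

(* Defs.v *)
From mathcomp Require Import all_boot all_order all_algebra.

Set Implicit Arguments.
Unset Strict Implicit.
Unset Printing Implicit Defensive.

(** First-order logic with equality, over one-sorted languages. *)

Record language := Language {
  fun_sym : Type;
  fun_arity : fun_sym -> nat;
  rel_sym : Type;
  rel_arity : rel_sym -> nat
}.

(** [term L n] and [formula L n] have their free variables in ['I_n] (de Bruijn
    indices): under a quantifier, [ord0] is the variable just bound and
    [lift ord0 i] is the variable that is [i] outside of the quantifier. *)
Inductive term (L : language) (n : nat) : Type :=
| Var of 'I_n
| App (f : fun_sym L) of ('I_(fun_arity f) -> term L n).

Inductive formula (L : language) (n : nat) : Type :=
| Bot
| Eq of term L n & term L n
| Rel (r : rel_sym L) of ('I_(rel_arity r) -> term L n)
| Not of formula L n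
| And of formula L n & formula L n
| Or of formula L n & formula L n
| Imp of formula L n & formula L n
| All of formula L n.+1
| Ex of formula L n.+1.

Arguments Var {L n}.
Arguments App {L n}.
Arguments Bot {L n}.
Arguments Rel {L n}.
Arguments Eq {L n} & _ _.
Arguments Not {L n} & _.
Arguments And {L n} & _ _.
Arguments Or {L n} & _ _.
Arguments Imp {L n} & _ _.
Arguments All {L n} & _.
Arguments Ex {L n} & _.

Definition sentence (L : language) := formula L 0.

Definition theory (L : language) := sentence L -> Prop.

Record structure (L : language) := Structure {
  carrier :> Type;
  carrier_nonempty : inhabited carrier;
  fun_interp : forall f : fun_sym L, ('I_(fun_arity f) -> carrier) -> carrier;
  rel_interp : forall r : rel_sym L, ('I_(rel_arity r) -> carrier) -> Prop
}.

Arguments fun_interp {L} _ _ _.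
Arguments rel_interp {L} _ _ _.

Section Semantics.
Variables (L : language) (M : structure L).

Fixpoint eval n (v : 'I_n -> M) (t : term L n) : M :=
  match t with
  | Var i => v i
  | App f ts => fun_interp M f (fun i => eval v (ts i))
  end.

Definition extend n (v : 'I_n -> M) (a : M) (i : 'I_n.+1) : M :=
  if unlift ord0 i is Some j then v j else a.

Fixpoint sat n (v : 'I_n -> M) (p : formula L n) {struct p} : Prop :=
  match p in formula _ _ with
  | Bot => False
  | Eq s t => eval v s = eval v t
  | Rel r ts => rel_interp M r (fun i => eval v (ts i))
  | Not p => ~ sat v p
  | And p q => sat v p /\ sat v q
  | Or p q => sat v p \/ sat v q
  | Imp p q => sat v p -> sat v q
  | All p => forall a : M, sat (extend v a) p
  | Ex p => exists a : M, sat (extend v a) p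
  end.

Definition no_var (i : 'I_0) : M :=
  match notF (ltn_ord i) with end.

Definition models (T : theory L) : Prop :=
  forall p : sentence L, T p -> sat no_var p.

End Semantics.

Section Embeddings.
Variables (L : language) (M N : structure L) (h : M -> N).

Definition embedding : Prop :=
  [/\ injective h,
      forall (f : fun_sym L) (xs : 'I_(fun_arity f) -> M),
        h (fun_interp M f xs) = fun_interp N f (fun i => h (xs i))
    & forall (r : rel_sym L) (xs : 'I_(rel_arity r) -> M),
        rel_interp M r xs <-> rel_interp N r (fun i => h (xs i))].

Definition elementary : Prop :=
  forall n (v : 'I_n -> M) (p : formula L n),
    sat v p <-> sat (fun i => h (v i)) p.

End Embeddings.

Definition model_complete L (T : theory L) : Prop :=
  forall (M N : structure L) (h : M -> N),
    models M T -> models N T -> embedding h -> elementary h.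

Definition models_embed L (T T' : theory L) : Prop :=
  forall M : structure L, models M T ->
    exists (N : structure L) (h : M -> N), models N T' /\ embedding h.

(** [model_companion T T'] says that [T'] is a model companion of [T]. *)
Definition model_companion L (T T' : theory L) : Prop :=
  [/\ models_embed T T', models_embed T' T & model_complete T'].

(** The language of ordered difference groups: +, -, 0, <, rho, rho^-1,
    where - is the unary opposite. *)

Inductive odg_fsym := Add | Opp | Zero | Rho | RhoInv.
Inductive odg_rsym := Lt.

Definition odg_language : language :=
  {| fun_sym := odg_fsym;
     fun_arity f := match f with Add => 2 | Zero => 0 | Opp | Rho | RhoInv => 1 end;
     rel_sym := odg_rsym;
     rel_arity _ := 2 |}.

Section Syntax.
Variable n : nat.
Implicit Types s t : term odg_language n.

Definition tvar (k : nat) (lt_k_n : k < n) : term odg_language n :=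
  Var (Ordinal lt_k_n).
Definition tadd s t : term odg_language n :=
  App (Add : fun_sym odg_language) (tnth [tuple s; t]).
Definition topp t : term odg_language n :=
  App (Opp : fun_sym odg_language) (tnth [tuple t]).
Definition tzero : term odg_language n :=
  App (Zero : fun_sym odg_language) (tnth [tuple]).
Definition trho t : term odg_language n :=
  App (Rho : fun_sym odg_language) (tnth [tuple t]).
Definition trhoinv t : term odg_language n :=
  App (RhoInv : fun_sym odg_language) (tnth [tuple t]).
Definition flt s t : formula odg_language n :=
  Rel (Lt : rel_sym odg_language) (tnth [tuple s; t]).

Definition tmuln (m : nat) t := iter m (tadd t) tzero.

Definition tmulz (m : int) t :=
  match m with Posz k => tmuln k t | Negz k => topp (tmuln k.+1 t) end.

(** The polynomial with coefficients [m_i] stands for the operator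
    [sum_i m_i rho^i]. *)
Definition tdiff (P : {poly int}) t :=
  \big[tadd/tzero]_(i < size P) tmulz (P`_i)%R (iter i trho t).

End Syntax.

Arguments tzero {n}.
Arguments tvar {n} & k lt_k_n.
Arguments tadd {n} & s t.
Arguments topp {n} & t.
Arguments trho {n} & t.
Arguments trhoinv {n} & t.
Arguments flt {n} & s t.
Arguments tdiff {n} & P t.

Declare Scope odg_scope.
Delimit Scope odg_scope with odg.

(** [#k] is the variable with de Bruijn index [k]. *)
Local Notation "# k" := (tvar k isT)
  (at level 0, k at level 0, format "# k") : odg_scope.
Local Notation "s + t" := (tadd s t) : odg_scope.
Local Notation "- t" := (topp t) : odg_scope.
Local Notation "0" := tzero : odg_scope.
Local Notation "s < t" := (flt s t) : odg_scope.
Local Notation "s = t" := (Eq s t) : odg_scope.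
Local Notation "p 'and' q" := (And p q) (at level 80, right associativity) : odg_scope.
Local Notation "p 'or' q" := (Or p q) (at level 85, right associativity) : odg_scope.
Local Notation "p 'implies' q" := (Imp p q) (at level 90, right associativity) : odg_scope.
Local Notation "'all' p" := (All p) (at level 95, right associativity) : odg_scope.
Local Notation "'ex' p" := (Ex p) (at level 95, right associativity) : odg_scope.

Local Open Scope odg_scope.

Definition additive_axiom (u : forall n, term odg_language n -> term odg_language n) :
  sentence odg_language :=
  all all (u 2 (#1 + #0) = u 2 #1 + u 2 #0).

Definition increasing_axiom (u : forall n, term odg_language n -> term odg_language n) :
  sentence odg_language :=
  all all (#1 < #0 implies u 2 #1 < u 2 #0).

Inductive ODAG : theory odg_language :=
| ODAG_add_assoc : ODAG (all all all (#2 + (#1 + #0) = (#2 + #1) + #0))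
| ODAG_add_comm : ODAG (all all (#1 + #0 = #0 + #1))
| ODAG_add_zero : ODAG (all (#0 + 0 = #0))
| ODAG_add_opp : ODAG (all (#0 + - #0 = 0))
| ODAG_lt_irrefl : ODAG (all Not (#0 < #0))
| ODAG_lt_trans : ODAG (all all all ((#2 < #1 and #1 < #0) implies #2 < #0))
| ODAG_lt_total : ODAG (all all (#1 < #0 or #1 = #0 or #0 < #1))
| ODAG_lt_add : ODAG (all all all (#2 < #1 implies #2 + #0 < #1 + #0))
| ODAG_rho_additive : ODAG (additive_axiom (@trho))
| ODAG_rho_increasing : ODAG (increasing_axiom (@trho))
| ODAG_rhoinv_additive : ODAG (additive_axiom (@trhoinv))
| ODAG_rhoinv_increasing : ODAG (increasing_axiom (@trhoinv))
| ODAG_rho_rhoinv : ODAG (all (trho (trhoinv #0) = #0))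
| ODAG_rhoinv_rho : ODAG (all (trhoinv (trho #0) = #0)).

Definition OM_axiom (P : {poly int}) : sentence odg_language :=
  (all (0 < #0 implies 0 < tdiff P #0))
  or (all (0 < #0 implies tdiff P #0 = 0))
  or (all (0 < #0 implies tdiff P #0 < 0)).

Inductive MODAG : theory odg_language :=
| MODAG_ODAG p of ODAG p : MODAG p
| MODAG_OM P : MODAG (OM_axiom P).

Definition nontrivial_axiom : sentence odg_language :=
  ex Not (#0 = 0).

Definition divisible_axiom (P : {poly int}) : sentence odg_language :=
  (all (tdiff P #0 = 0)) or (all ex (tdiff P #0 = #1)).

Inductive MODDAG : theory odg_language :=
| MODDAG_MODAG p of MODAG p : MODDAG p
| MODDAG_nontrivial : MODDAG nontrivial_axiom
| MODDAG_divisible P : MODDAG (divisible_axiom P).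

(* Main.v *)
(** Axiom OM says that in a nontrivial model the sign of [L x], for [x > 0],
    depends on [L] alone: it is a multiplicative map [sigma] from [Z[rho]] to
    [{-1, 0, 1}], and the model is an ordered module over the ordered domain
    [Z[rho] / ker sigma]. The models of MODDAG are the nontrivial ones that are
    divisible by every [L] with [sigma L <> 0], that is, the ordered vector
    spaces over the fraction field. Hence localizing a nontrivial model of MODAG
    at [{L | sigma L = 1}] embeds it in a model of MODDAG (the trivial group is
    first embedded in [Z] with [rho = id]).

    For model completeness, to each formula is attached a finite list of linear
    forms whose signs, at a tuple of any model of MODDAG with a given [sigma],
    determine whether the formula holds. For a quantifier the list is obtained by
    Fourier-Motzkin elimination: if two tuples agree on it, the order being dense
    without endpoints, an element chosen over the first tuple can be matched over
    the second. *)
From HB Require Import structures.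
From mathcomp Require Import all_boot all_order all_algebra.
From mathcomp Require Import generic_quotient boolp ring.
Require Import Defs.

Set Implicit Arguments.
Unset Strict Implicit.
Unset Printing Implicit Defensive.

Import GRing.Theory Num.Theory.
Local Open Scope ring_scope.
Local Open Scope quotient_scope.

(** * Modules over the ring of difference operators *)

Lemma morphD0 (U V : zmodType) (f : U -> V) :
  {morph f : x y / x + y} -> f 0 = 0.
Proof. by move=> fD; apply: (addIr (f 0)); rewrite -fD !add0r. Qed.

Lemma morphDN (U V : zmodType) (f : U -> V) :
  {morph f : x y / x + y} -> {morph f : x / - x}.
Proof. by move=> fD x; apply: (addIr (f x)); rewrite -fD !addNr morphD0. Qed.

Lemma morphDMz (U V : zmodType) (f : U -> V) n :
  {morph f : x y / x + y} -> {morph f : x / x *~ n}.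
Proof.
move=> fD x.
have fMn m : f (x *+ m) = f x *+ m.
  by elim: m => [|m IH]; rewrite ?mulr0n ?morphD0 // !mulrS fD IH.
by case: n => n; rewrite ?NegzE ?mulrNz ?(morphDN fD) -!pmulrn fMn.
Qed.

Section ActionOfPolynomials.
Variables (V : zmodType) (r : V -> V).
Hypothesis rD : {morph r : x y / x + y}.

Definition poly_act (P : {poly int}) (x : V) : V :=
  \sum_(i < size P) iter i r x *~ P`_i.

(** Padding with zero coefficients gives polynomials of different sizes a common range of
    summation. *)
Lemma poly_act_widen n (P : {poly int}) x : (size P <= n)%N ->
  poly_act P x = \sum_(i < n) iter i r x *~ P`_i.
Proof.
move=> le_n; rewrite /poly_act (big_ord_widen n (fun i => iter i r x *~ P`_i)) //.
rewrite big_mkcond; apply: eq_bigr => i _.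
by case: ltnP => // /(nth_default 0) ->; rewrite mulr0z.
Qed.

Lemma poly_actDl x : {morph poly_act^~ x : P Q / P + Q}.
Proof.
move=> P Q; set n := maxn (size P) (size Q).
rewrite (@poly_act_widen n (P + Q)%R _) ?size_polyD //.
rewrite (@poly_act_widen n P _) ?leq_maxl // (@poly_act_widen n Q _) ?leq_maxr //.
by rewrite -big_split; apply: eq_bigr => i _; rewrite coefD mulrzDr.
Qed.

Lemma poly_actDr : right_distributive poly_act +%R.
Proof.
move=> P x y; rewrite -big_split; apply: eq_bigr => i _ /=.
rewrite -mulrzDl; congr (_ *~ _).
by elim: (nat_of_ord i) => //= k ->; rewrite rD.
Qed.

Lemma poly_actC c x : poly_act c%:P x = x *~ c.
Proof.
by rewrite (@poly_act_widen 1) ?size_polyC_leq1 // big_ord1 coefC eqxx.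
Qed.

Lemma poly_actMX (P : {poly int}) x : poly_act (P * 'X) x = poly_act P (r x).
Proof.
have le_n : (size (P * 'X)%R <= (size P).+1)%N.
  by have [->|/size_mulX ->] := eqVneq P 0; rewrite ?mul0r ?size_poly0.
rewrite (poly_act_widen x le_n) big_ord_recl coefMX eqxx mulr0z add0r.
by apply: eq_bigr => i _; rewrite coefMX /= -iterSr.
Qed.

Lemma poly_actA (P Q : {poly int}) x : poly_act P (poly_act Q x) = poly_act (P * Q) x.
Proof.
have act0 y : poly_act 0 y = 0 by rewrite -[0]/(0%:P) poly_actC mulr0z.
elim/poly_ind: P => [|P c IH] in x *; first by rewrite mul0r !act0.
rewrite mulrDl !poly_actDl poly_actC poly_actMX.
(* Being additive, [r] commutes with integer multiples and sums of its own iterates. *)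
have -> : r (poly_act Q x) = poly_act Q (r x).
  rewrite [LHS](big_morph _ rD (morphD0 rD)); apply: eq_bigr => i _.
  by rewrite (morphDMz _ rD) -iterSr.
rewrite IH -poly_actMX mulrAC; congr (_ + _).
by rewrite mul_polyC -[c in RHS]intz scaler_int (morphDMz _ (poly_actDl x)).
Qed.

Lemma poly_act1 : left_id 1 poly_act.
Proof. by move=> x; rewrite -[1]/(1%:P) poly_actC mulr1z. Qed.

(** The alias keeps the additivity proof in the type, from which the module structure is then
    inferred. *)
Definition poly_module of {morph r : x y / x + y} : Type := V.

HB.instance Definition _ := GRing.Zmodule.on (poly_module rD).
HB.instance Definition _ :=
  GRing.Zmodule_isLmodule.Build {poly int} (poly_module rD)
    poly_actA poly_act1 poly_actDr (fun x => poly_actDl x).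

Lemma poly_moduleX (x : poly_module rD) : 'X *: x = r x.
Proof. by rewrite -['X]mul1r; apply: etrans (poly_actMX 1 x) (poly_act1 _). Qed.

End ActionOfPolynomials.

(** * Ordered modules presented by sign functions *)

(** With signs in place of an order relation, Axiom OM becomes the product rule [signZ]. By
    [sign_pos] there is a positive vector, so [s] determines [sigma]. *)
Record ordered_module (V : lmodType {poly int}) (sigma : {poly int} -> int)
    (s : V -> int) : Prop := OrderedModule {
  sign_cases : forall x, [\/ s x = 1, s x = 0 | s x = -1];
  sign_eq0 : forall x, s x = 0 <-> x = 0;
  signN : forall x, s (- x) = - s x;
  signD : forall x y, s x = 1 -> s y = 1 -> s (x + y) = 1;
  signZ : forall P x, s (P *: x) = sigma P * s x;
  sigmaX : sigma 'X = 1;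
  sign_pos : exists x, s x = 1
}.

Definition divisible (V : lmodType {poly int}) (sigma : {poly int} -> int) :=
  forall P, sigma P <> 0 -> forall y : V, exists x, P *: x = y.

Section OrderedModule.
Variables (V : lmodType {poly int}) (sigma : {poly int} -> int) (s : V -> int).
Hypothesis om : ordered_module sigma s.
Implicit Types (P Q : {poly int}) (x y : V).

Lemma sign0 : s 0 = 0.
Proof. exact/(sign_eq0 om). Qed.

(** This and the next identities for [sigma] are read off by letting operators act on one vector of
    sign 1. *)
Lemma sigmaM P Q : sigma (P * Q) = sigma P * sigma Q.
Proof.
have [x x1] := sign_pos om.
by have := signZ om (P * Q) x; rewrite -scalerA !(signZ om) x1 !mulr1 => <-.
Qed.

Lemma sigma1 : sigma 1 = 1.
Proof.
by have [x x1] := sign_pos om; have := signZ om 1 x; rewrite scale1r x1 mulr1.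
Qed.

Lemma sigmaN P : sigma (- P) = - sigma P.
Proof.
have [x x1] := sign_pos om; have := signZ om (- P) x.
by rewrite scaleNr (signN om) (signZ om) x1 !mulr1.
Qed.

Lemma sigma2 : sigma 2%:R = 1.
Proof.
have [x x1] := sign_pos om; have := signZ om 2%:R x.
by rewrite x1 mulr1 => <-; rewrite scaler_nat mulr2n (signD om).
Qed.

Lemma sigmaXn k : sigma 'X^k = 1.
Proof. by elim: k => [|k IH]; rewrite ?sigma1 // exprS sigmaM IH (sigmaX om). Qed.

Lemma sigma_cases P : [\/ sigma P = 1, sigma P = 0 | sigma P = -1].
Proof.
have [x x1] := sign_pos om; have := sign_cases om (P *: x).
by rewrite (signZ om) x1 mulr1.
Qed.

(** The sign of [P *: (x - y)] is a product of two integers, so it vanishes only if a factor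
    does. *)
Lemma scale_sigma_inj P x y : sigma P <> 0 -> P *: x = P *: y -> x = y.
Proof.
move=> P0 /eqP; rewrite -subr_eq0 -scalerBr => /eqP/(sign_eq0 om)/eqP.
rewrite (signZ om) mulf_eq0 => /orP[/eqP //|/eqP/(sign_eq0 om)/eqP].
by rewrite subr_eq0 => /eqP.
Qed.

End OrderedModule.

(** * Localization *)

Section Localization.
Variables (V : lmodType {poly int}) (sigma : {poly int} -> int) (s : V -> int).
Hypothesis om : ordered_module sigma s.

(** With denominators of sign 1, a fraction has the sign of its numerator. Division by [P] of sign
    -1 is still available, through [- P]. *)
Definition denominator := {L : {poly int} | sigma L == 1}.

Definition fraction_rep : Type := (V * denominator)%type.
HB.instance Definition _ := Choice.on fraction_rep.

Implicit Types (p q : fraction_rep) (L : denominator).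

Lemma denominatorP L : sigma (val L) = 1.
Proof. by apply/eqP; case: L. Qed.

Lemma denominator_neq0 L : sigma (val L) <> 0.
Proof. by rewrite denominatorP. Qed.

Lemma denominator_mul_subproof L L' : sigma (val L * val L') == 1.
Proof. by rewrite (sigmaM om) !denominatorP. Qed.

Definition denominator_mul L L' : denominator :=
  exist _ (val L * val L') (denominator_mul_subproof L L').

Definition denominator1 : denominator := exist _ 1 (introT eqP (sigma1 om)).

(** Denominators act injectively, so cross-multiplication is already transitive without the extra
    multiplier of general localizations. *)
Definition fraction_equiv p q := val q.2 *: p.1 == val p.2 *: q.1.

Lemma fraction_equiv_refl : reflexive fraction_equiv.
Proof. by move=> p; rewrite /fraction_equiv. Qed.

Lemma fraction_equiv_sym : symmetric fraction_equiv.
Proof. by move=> p q; rewrite /fraction_equiv eq_sym. Qed.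

Lemma fraction_equiv_trans : transitive fraction_equiv.
Proof.
move=> [y K] [x L] [z J]; rewrite /fraction_equiv /= => /eqP xy /eqP yz.
(* The denominator [K] of the middle fraction is cancelled. *)
apply/eqP/(scale_sigma_inj om (@denominator_neq0 K)).
by rewrite scalerA mulrC -scalerA xy scalerA mulrC -scalerA yz !scalerA mulrC.
Qed.

Canonical fraction_equivalence :=
  EquivRel fraction_equiv fraction_equiv_refl fraction_equiv_sym
    fraction_equiv_trans.

Definition localization := {eq_quot fraction_equivalence}.
HB.instance Definition _ := Choice.on localization.

Definition frac x L : localization := \pi_localization (x, L).

Lemma fracP (u : localization) : exists x L, u = frac x L.
Proof.
by exists (repr u).1, (repr u).2; rewrite /frac -surjective_pairing reprK.
Qed.

Lemma eq_frac x L y L' : frac x L = frac y L' <-> val L' *: x = val L *: y.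
Proof.
by split=> [/eqP|/eqP h]; [|apply/eqP]; rewrite eqmodE => // /eqP.
Qed.

Lemma repr_frac x L : exists K : denominator, exists y,
  repr (frac x L) = (y, K) /\ val L *: y = val K *: x.
Proof.
case def_r: (repr _) => [y K]; exists K, y; split=> //.
by apply/eq_frac; rewrite /frac -def_r reprK.
Qed.

(** The operations and the sign use the representatives chosen by [repr]; [loc_addE] to [loc_signE]
    show that any others give the same result. *)
Definition loc_add (u v : localization) : localization :=
  frac (val (repr v).2 *: (repr u).1 + val (repr u).2 *: (repr v).1)
    (denominator_mul (repr u).2 (repr v).2).

Definition loc_opp (u : localization) : localization :=
  frac (- (repr u).1) (repr u).2.

Definition loc_scale P (u : localization) : localization :=
  frac (P *: (repr u).1) (repr u).2.

Definition loc_sign (u : localization) : int := s (repr u).1.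

Lemma loc_addE x L y K :
  loc_add (frac x L) (frac y K) = frac (val K *: x + val L *: y)
    (denominator_mul L K).
Proof.
rewrite /loc_add; have [L' [x' [-> /= ex]]] := repr_frac x L.
have [K' [y' [-> /= ey]]] := repr_frac y K; apply/eq_frac => /=.
rewrite !scalerDr !scalerA; congr (_ + _).
  rewrite (_ : _ * _ * _ = sval K' * sval K * sval L); last by ring.
  by rewrite -scalerA ex scalerA; congr (_ *: _); ring.
rewrite (_ : _ * _ * _ = sval L' * sval L * sval K); last by ring.
by rewrite -scalerA ey scalerA; congr (_ *: _); ring.
Qed.

Lemma loc_oppE x L : loc_opp (frac x L) = frac (- x) L.
Proof.
rewrite /loc_opp; have [L' [x' [-> /= ex]]] := repr_frac x L; apply/eq_frac.
by rewrite /= !scalerN ex.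
Qed.

Lemma loc_scaleE P x L : loc_scale P (frac x L) = frac (P *: x) L.
Proof.
rewrite /loc_scale; have [L' [x' [-> /= ex]]] := repr_frac x L; apply/eq_frac.
by rewrite /= !scalerA ![_ * P]mulrC -!scalerA ex.
Qed.

Lemma loc_signE x L : loc_sign (frac x L) = s x.
Proof.
rewrite /loc_sign; have [L' [x' [-> /= ex]]] := repr_frac x L.
by have := congr1 s ex; rewrite !(signZ om) !denominatorP !mul1r.
Qed.

Lemma loc_addA : associative loc_add.
Proof.
move=> u v w; have [x [L ->]] := fracP u; have [y [K ->]] := fracP v.
have [z [J ->]] := fracP w; rewrite !loc_addE; congr frac => /=.
  by rewrite !scalerDr !scalerA !addrA; congr (_ *: _ + _ *: _ + _); ring.
by apply: val_inj => /=; rewrite mulrA.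
Qed.

Lemma loc_addC : commutative loc_add.
Proof.
move=> u v; have [x [L ->]] := fracP u; have [y [K ->]] := fracP v.
rewrite !loc_addE addrC; congr frac.
by apply: val_inj => /=; rewrite mulrC.
Qed.

Lemma loc_add0 : left_id (frac 0 denominator1) loc_add.
Proof.
move=> u; have [x [L ->]] := fracP u.
by rewrite loc_addE scaler0 add0r scale1r; apply/eq_frac; rewrite /= mul1r.
Qed.

Lemma loc_addN : left_inverse (frac 0 denominator1) loc_opp loc_add.
Proof.
move=> u; have [x [L ->]] := fracP u.
by rewrite loc_oppE loc_addE scalerN addNr; apply/eq_frac; rewrite !scaler0.
Qed.

HB.instance Definition _ := GRing.isZmodule.Build localization
  loc_addA loc_addC loc_add0 loc_addN.

Lemma loc_scaleA P Q u : loc_scale P (loc_scale Q u) = loc_scale (P * Q) u.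
Proof. by have [x [L ->]] := fracP u; rewrite !loc_scaleE scalerA. Qed.

Lemma loc_scale1 : left_id 1 loc_scale.
Proof. by move=> u; have [x [L ->]] := fracP u; rewrite loc_scaleE scale1r. Qed.

Lemma loc_scaleDr : right_distributive loc_scale loc_add.
Proof.
move=> P u v; have [x [L ->]] := fracP u; have [y [K ->]] := fracP v.
rewrite !(loc_scaleE, loc_addE) scalerDr !scalerA.
by congr (frac (_ *: _ + _ *: _)); ring.
Qed.

Lemma loc_scaleDl u P Q :
  loc_scale (P + Q) u = loc_add (loc_scale P u) (loc_scale Q u).
Proof.
have [x [L ->]] := fracP u; rewrite !loc_scaleE loc_addE; apply/eq_frac => /=.
by rewrite -!scalerDr -scalerDl scalerA.
Qed.

HB.instance Definition _ := GRing.Zmodule_isLmodule.Build {poly int} localization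
  loc_scaleA loc_scale1 loc_scaleDr loc_scaleDl.

Lemma fracD x L y K : frac x L + frac y K =
  frac (val K *: x + val L *: y) (denominator_mul L K).
Proof. exact: loc_addE. Qed.

Lemma fracN x L : - frac x L = frac (- x) L.
Proof. exact: loc_oppE. Qed.

Lemma fracZ P x L : P *: frac x L = frac (P *: x) L.
Proof. exact: loc_scaleE. Qed.

Lemma frac_eq0 x L : frac x L = 0 <-> x = 0.
Proof.
split=> [/eq_frac|->]; first by rewrite /= scale1r scaler0.
by apply/eq_frac; rewrite !scaler0.
Qed.

Lemma localization_ordered : ordered_module (V := localization) sigma loc_sign.
Proof.
split.
- by move=> u; exact: (sign_cases om).
- move=> u; have [x [L ->]] := fracP u.
  by rewrite loc_signE frac_eq0; exact: sign_eq0 om x.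
- move=> u; have [x [L ->]] := fracP u.
  by rewrite fracN !loc_signE (signN om).
- move=> u v; have [x [L ->]] := fracP u; have [y [K ->]] := fracP v.
  rewrite fracD !loc_signE => x1 y1.
  by apply: (signD om); rewrite (signZ om) denominatorP mul1r.
- by move=> P u; have [x [L ->]] := fracP u; rewrite fracZ !loc_signE (signZ om).
- exact: sigmaX om.
- by have [x x1] := sign_pos om; exists (frac x denominator1); rewrite loc_signE.
Qed.

Lemma localization_divisible : divisible localization sigma.
Proof.
move=> P P0 u; have [x [L ->]] := fracP u.
(* Sign -1 reduces to sign 1 by negating both the operator and the quotient. *)
suff H Q : sigma Q = 1 -> exists v : localization, Q *: v = frac x L.
  case: (sigma_cases om P) => [/H //|//|P1].
  have [|v <-] := H (- P); first by rewrite (sigmaN om) P1.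
  by exists (- v); rewrite scalerN scaleNr.
move=> Q1; have QL : sigma (Q * val L) == 1.
  by rewrite (sigmaM om) Q1 denominatorP.
(* The divisor [Q] is absorbed into the denominator. *)
pose K : denominator := exist _ (Q * val L) QL.
exists (frac x K); rewrite fracZ; apply/eq_frac => /=.
by rewrite scalerA mulrC.
Qed.

Definition loc_embed x : localization := frac x denominator1.

Lemma loc_embedD : {morph loc_embed : x y / x + y}.
Proof.
move=> x y; rewrite /loc_embed fracD /= !scale1r.
by apply/eq_frac; rewrite /= mulr1.
Qed.

End Localization.

(** * Elimination of a variable *)

Section DenseOrder.
Variables (V : lmodType {poly int}) (sigma : {poly int} -> int) (s : V -> int).
Hypothesis om : ordered_module sigma s.
Hypothesis div : divisible V sigma.

Lemma sign_trans x y z : s (y - x) = 1 -> s (z - y) = 1 -> s (z - x) = 1.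
Proof. by move=> xy yz; rewrite -(subrK y z) -addrA (signD om). Qed.

Lemma sign_opp x y : s (x - y) = - s (y - x).
Proof. by rewrite -(signN om) opprB. Qed.

Lemma exists_max (A : seq V) : A <> [::] ->
  exists2 m, m \in A & forall x, x \in A -> x = m \/ s (m - x) = 1.
Proof.
elim: A => // a A IH _; have [->|] := eqVneq A [::].
  by exists a; rewrite ?mem_head // => x; rewrite inE => /eqP; left.
move/eqP/IH => [m mA max_m]; case: (sign_cases om (m - a)) => ma.
- exists m; first by rewrite inE mA orbT.
  by move=> x; rewrite inE => /orP[/eqP->|/max_m]; [right|].
- exists m; first by rewrite inE mA orbT.
  move=> x; rewrite inE => /orP[/eqP->|/max_m //]; left.
  by have /(sign_eq0 om)/eqP := ma; rewrite subr_eq0 => /eqP.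
- exists a; first exact: mem_head.
  have am : s (a - m) = 1 by rewrite sign_opp ma opprK.
  move=> x; rewrite inE => /orP[/eqP->|/max_m[->|mx]]; [by left|by right|right].
  exact: (sign_trans mx am).
Qed.

Lemma exists_min (A : seq V) : A <> [::] ->
  exists2 m, m \in A & forall x, x \in A -> x = m \/ s (x - m) = 1.
Proof.
move=> A0; have [|_ /mapP[m mA ->] min_m] := @exists_max (map -%R A).
  by case: A A0.
exists m => // x xA; have /min_m[/oppr_inj|] : - x \in map -%R A.
- exact: map_f.
- by left.
- by rewrite opprK addrC; right.
Qed.

(** The order is dense without endpoints. If both sets are nonempty, the midpoint of [max A] and
    [min B] exists by divisibility by 2; if only one is, its extremum is shifted by a positive
    vector. *)
Lemma exists_between (A B : seq V) :
    (forall a b, a \in A -> b \in B -> s (b - a) = 1) ->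
  exists c, (forall a, a \in A -> s (c - a) = 1) /\
            (forall b, b \in B -> s (b - c) = 1).
Proof.
move=> AB; have [e e1] := sign_pos om.
have [->|/eqP/exists_max[m mA max_m]] := eqVneq A [::];
  have [->|/eqP/exists_min[m' mB min_m]] := eqVneq B [::].
- by exists 0.
- exists (m' - e); split=> // b /min_m[->|bm]; first by rewrite opprB addrC subrK.
  by apply: (sign_trans (y := m')) bm; rewrite opprB addrC subrK.
- exists (m + e); split=> // a /max_m[->|am]; first by rewrite addrC addKr.
  by apply: (sign_trans (y := m)) am _; rewrite addrC addKr.
have [c0] : exists c, 2%:R *: c = m + m'.
  by apply: div; rewrite (sigma2 om).
rewrite scaler_nat mulr2n => cE; exists c0.
(* Doubling keeps signs, so both inequalities for the midpoint may be checked after doubling. *)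
have half x : s (x + x) = s x.
  by rewrite -mulr2n -scaler_nat (signZ om) (sigma2 om) mul1r.
have mm' := AB _ _ mA mB.
have cm : s (c0 - m) = 1.
  by rewrite -half addrACA cE addrACA subrr add0r.
have m'c : s (m' - c0) = 1.
  by rewrite -half addrACA -opprD cE opprD addrACA subrr addr0.
split=> [a /max_m[->//|am]|b /min_m[->//|bm]].
  exact: (sign_trans am cm).
exact: (sign_trans m'c bm).
Qed.

End DenseOrder.

(** * Linear forms and Fourier-Motzkin elimination *)

Definition linear_form n := {ffun 'I_n -> {poly int}}.

Definition lin_eval n (V : lmodType {poly int}) (f : linear_form n)
  (x : 'I_n -> V) : V := \sum_i f i *: x i.

Definition signs_agree n (V W : lmodType {poly int}) (s : V -> int)
    (s' : W -> int) (F : seq (linear_form n)) (x : 'I_n -> V) (y : 'I_n -> W) :=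
  forall f, f \in F -> s (lin_eval f x) = s' (lin_eval f y).

Definition form_tail n (f : linear_form n.+1) : linear_form n :=
  [ffun i => f (lift ord0 i)].

Definition form_comb n (P : {poly int}) (f : linear_form n) (Q : {poly int})
  (g : linear_form n) : linear_form n := [ffun i => P * f i + Q * g i].

(* The combination of [f] and [g] in which the first variable cancels. *)
Definition form_elim n (f g : linear_form n.+1) : linear_form n :=
  form_comb (f ord0) (form_tail g) (- g ord0) (form_tail f).

(** The tails serve the forms whose first coefficient has sign 0, the combinations compare the roots
    of two forms. All forms and pairs are kept, since the list must not depend on [sigma], which
    decides which coefficients have sign 0. *)
Definition eliminate n (F : seq (linear_form n.+1)) : seq (linear_form n) :=
  map (@form_tail n) F ++ [seq form_elim f g | f <- F, g <- F].

Lemma lin_eval_comb n (V : lmodType {poly int}) P (f : linear_form n) Q g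
    (x : 'I_n -> V) :
  lin_eval (form_comb P f Q g) x = P *: lin_eval f x + Q *: lin_eval g x.
Proof.
rewrite /lin_eval !scaler_sumr -big_split; apply: eq_bigr => i _.
by rewrite ffunE scalerDl !scalerA.
Qed.

Section BackAndForth.
Variables (V W : lmodType {poly int}) (sigma : {poly int} -> int).
Variables (s : V -> int) (s' : W -> int).
Hypotheses (omV : ordered_module sigma s) (omW : ordered_module sigma s').
Hypotheses (divV : divisible V sigma) (divW : divisible W sigma).

(** If [a] equals some [r i], then [t i] matches it. Otherwise the points below and above [a] have
    images that are separated in the same way, and [b] is taken between them. *)
Lemma extend_cut (I : eqType) (F : seq I) (r : I -> V) (t : I -> W) (a : V) :
    (forall i j, i \in F -> j \in F -> s (r i - r j) = s' (t i - t j)) ->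
  exists b, forall i, i \in F -> s (a - r i) = s' (b - t i).
Proof.
move=> rt; have [/hasP[i iF /eqP ai]|/hasPn a_r] := boolP (has (fun i => r i == a) F).
  by exists (t i) => j jF; rewrite -ai rt.
pose A := [seq i <- F | s (a - r i) == 1].
pose B := [seq i <- F | s (r i - a) == 1].
have [_ _ /mapP[i iA ->] /mapP[j jB ->]|b [bA bB]] :=
    @exists_between W sigma s' omW divW (map t A) (map t B).
  move: iA jB; rewrite !mem_filter => /andP[/eqP ai iF] /andP[/eqP ja jF].
  by rewrite -rt //; exact: (sign_trans omV ai ja).
exists b => i iF; case: (sign_cases omV (a - r i)) => ai.
- by rewrite ai bA // map_f // mem_filter ai eqxx.
- have := a_r i iF.
  by have /(sign_eq0 omV)/eqP := ai; rewrite subr_eq0 eq_sym => ->.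
- rewrite ai (sign_opp omW) bB // map_f // mem_filter iF andbT.
  by rewrite (sign_opp omV) ai opprK.
Qed.

(** A form whose first coefficient has nonzero sign takes at [a] the sign of that coefficient times
    the sign of [a] minus its root. Hence [b] has to lie among the roots over [y] as [a] lies among
    the roots over [x], and the eliminated forms say that these roots are ordered alike. *)
Lemma back_and_forth n (F : seq (linear_form n.+1)) (x : 'I_n -> V)
    (y : 'I_n -> W) (a : V) :
  signs_agree s s' (eliminate F) x y ->
  exists b : W, forall f, f \in F ->
    s (f ord0 *: a + lin_eval (form_tail f) x) =
    s' (f ord0 *: b + lin_eval (form_tail f) y).
Proof.
move=> agree; pose G := [seq f : linear_form n.+1 <- F | sigma (f ord0) != 0].
(* Divisibility gives each form of [G] a root in its first variable; choice picks them all at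
   once. *)
have root (U : lmodType {poly int}) (z : 'I_n -> U) : divisible U sigma ->
    exists r : linear_form n.+1 -> U, forall f, f \in G ->
      f ord0 *: r f = - lin_eval (form_tail f) z.
  move=> divU; pose P (f : linear_form n.+1) u :=
    f \in G -> f ord0 *: u = - lin_eval (form_tail f) z.
  suff /choice[r rP] : forall f, exists u, P f u by exists r.
  rewrite /P => f.
  have [|fG] := boolP (f \in G); last by exists 0.
  rewrite mem_filter => /andP[/eqP f0 _].
  by have [u uE] := divU _ f0 (- lin_eval (form_tail f) z); exists u.
have [r rE] := root V x divV; have [t tE] := root W y divW.
have elimE (U : lmodType {poly int}) (z : 'I_n -> U) u (f g : linear_form n.+1) :
    (forall f : linear_form n.+1, f \in G -> f ord0 *: u f = - lin_eval (form_tail f) z) ->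
    f \in G -> g \in G ->
  (f ord0 * g ord0) *: (u f - u g) = lin_eval (form_elim f g) z.
  move=> uE fG gG; rewrite lin_eval_comb scalerBr {1}mulrC -!scalerA !uE //.
  by rewrite scaleNr !scalerN opprK addrC.
have subG (f : linear_form n.+1) : f \in G -> sigma (f ord0) != 0 /\ f \in F.
  by rewrite mem_filter => /andP.
have [f g fG gG|b bE] := @extend_cut _ G r t a.
  have [f0 fF] := subG _ fG; have [g0 gF] := subG _ gG.
  (* Multiplying by the nonzero sign of the two first coefficients turns the difference of roots
     into the value of [form_elim f g]. *)
  apply: (mulfI (x := sigma (f ord0) * sigma (g ord0))); first by rewrite mulf_neq0.
  rewrite -(sigmaM omV) -(signZ omV) -(signZ omW) (elimE _ x) // (elimE _ y) //.
  by apply: agree; rewrite mem_cat allpairs_f ?orbT.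
(* A first coefficient of sign 0 annihilates both modules, which leaves only the tails. *)
exists b => f fF; have [f0|f0] := eqVneq (sigma (f ord0)) 0.
  have f0z (U : lmodType {poly int}) (su : U -> int) (u : U) :
      ordered_module sigma su -> f ord0 *: u = 0.
    by move=> omU; apply/(sign_eq0 omU); rewrite (signZ omU) f0 mul0r.
  rewrite (f0z _ _ _ omV) (f0z _ _ _ omW) !add0r.
  by apply: agree; rewrite mem_cat map_f.
have fG : f \in G by rewrite mem_filter f0.
rewrite -[lin_eval _ x]opprK -[lin_eval _ y]opprK -rE // -tE // -!scalerBr.
by rewrite (signZ omV) (signZ omW) bE.
Qed.

End BackAndForth.

(** Stated for operations on a bare type, so as to apply to the carrier of a structure;
    [{classic T}] supplies the choice operator that a [zmodType] requires. *)
Lemma lmodType_of_group (T : Type) (zero : T) (opp : T -> T) (add : T -> T -> T)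
    (r : T -> T) :
    associative add -> commutative add -> left_id zero add ->
    left_inverse zero opp add -> {morph r : x y / add x y} ->
  exists (V : lmodType {poly int}) (phi : T -> V),
    [/\ bijective phi, forall x y, phi (add x y) = phi x + phi y
      & forall x, phi (r x) = 'X *: phi x].
Proof.
move=> addA addC add0 addN rD.
pose Z : zmodType := HB.pack {classic T}
  (GRing.isZmodule.Build {classic T} addA addC add0 addN).
pose V : lmodType {poly int} := @poly_module Z r rD.
exists V, (id : T -> V); split=> // [|x]; first by exists id.
exact: esym (@poly_moduleX Z r rD x).
Qed.

(** * Structures and modules *)

Section Terms.
Variable M : structure odg_language.

Definition madd (x y : M) : M :=
  fun_interp M (Add : fun_sym odg_language) (tnth [tuple x; y]).
Definition mopp (x : M) : M :=
  fun_interp M (Opp : fun_sym odg_language) (tnth [tuple x]).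
Definition mzero : M :=
  fun_interp M (Zero : fun_sym odg_language) (tnth [tuple]).
Definition mrho (x : M) : M :=
  fun_interp M (Rho : fun_sym odg_language) (tnth [tuple x]).
Definition mrhoinv (x : M) : M :=
  fun_interp M (RhoInv : fun_sym odg_language) (tnth [tuple x]).
Definition mlt (x y : M) : Prop :=
  rel_interp M (Lt : rel_sym odg_language) (tnth [tuple x; y]).

(** Arguments of symbols are functions on ordinals, so these reductions to named operations rest on
    functional extensionality. *)
Lemma fun_interp_add (xs : 'I_2 -> M) :
  fun_interp M (Add : fun_sym odg_language) xs = madd (xs ord0) (xs ord_max).
Proof.
by congr fun_interp; apply/funext => -[[|[|k]] lt_k] //=; congr xs; exact: val_inj.
Qed.

Lemma fun_interp_opp (xs : 'I_1 -> M) :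
  fun_interp M (Opp : fun_sym odg_language) xs = mopp (xs ord0).
Proof. by congr fun_interp; apply/funext => i; rewrite ord1. Qed.

Lemma fun_interp_zero (xs : 'I_0 -> M) :
  fun_interp M (Zero : fun_sym odg_language) xs = mzero.
Proof. by congr fun_interp; apply/funext => -[]. Qed.

Lemma fun_interp_rho (xs : 'I_1 -> M) :
  fun_interp M (Rho : fun_sym odg_language) xs = mrho (xs ord0).
Proof. by congr fun_interp; apply/funext => i; rewrite ord1. Qed.

Lemma fun_interp_rhoinv (xs : 'I_1 -> M) :
  fun_interp M (RhoInv : fun_sym odg_language) xs = mrhoinv (xs ord0).
Proof. by congr fun_interp; apply/funext => i; rewrite ord1. Qed.

Lemma rel_interp_lt (xs : 'I_2 -> M) :
  rel_interp M (Lt : rel_sym odg_language) xs = mlt (xs ord0) (xs ord_max).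
Proof.
by congr rel_interp; apply/funext => -[[|[|k]] lt_k] //=; congr xs; exact: val_inj.
Qed.

Section Eval.
Variables (n : nat) (v : 'I_n -> M).
Implicit Types t u : term odg_language n.

Lemma eval_tadd t u : eval v (tadd t u) = madd (eval v t) (eval v u).
Proof. by congr fun_interp; apply/funext => -[[|[|k]] lt_k]. Qed.

Lemma eval_topp t : eval v (topp t) = mopp (eval v t).
Proof. by congr fun_interp; apply/funext => -[[|k] lt_k]. Qed.

Lemma eval_tzero : eval v tzero = mzero.
Proof. by congr fun_interp; apply/funext => -[]. Qed.

Lemma eval_trho t : eval v (trho t) = mrho (eval v t).
Proof. by congr fun_interp; apply/funext => -[[|k] lt_k]. Qed.

Lemma eval_trhoinv t : eval v (trhoinv t) = mrhoinv (eval v t).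
Proof. by congr fun_interp; apply/funext => -[[|k] lt_k]. Qed.

Lemma eval_tvar k (lt_k : (k < n)%N) : eval v (tvar k lt_k) = v (Ordinal lt_k).
Proof. by []. Qed.

Lemma rel_interp_eval_lt t u :
  rel_interp M (Lt : rel_sym odg_language) (fun i => eval v (tnth [tuple t; u] i)) =
  mlt (eval v t) (eval v u).
Proof. by congr rel_interp; apply/funext => -[[|[|k]] lt_k]. Qed.

Lemma extend_ord0 a : extend v a ord0 = a.
Proof. by rewrite /extend unlift_none. Qed.

Lemma extend_lift a i : extend v a (lift ord0 i) = v i.
Proof. by rewrite /extend liftK. Qed.

Lemma extend0 a (lt_k : (0 < n.+1)%N) : extend v a (Ordinal lt_k) = a.
Proof. by rewrite -[RHS](extend_ord0 a); congr extend; exact: val_inj. Qed.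

Lemma extendS a k (lt_k : (k.+1 < n.+1)%N) :
  extend v a (Ordinal lt_k) = v (Ordinal (lt_k : (k < n)%N)).
Proof. by rewrite -[RHS](extend_lift a); congr extend; exact: val_inj. Qed.

End Eval.

Definition evalE :=
  (eval_tadd, eval_topp, eval_tzero, eval_trho, eval_trhoinv, rel_interp_eval_lt,
   eval_tvar, extend0, extendS).

End Terms.

Arguments eval : simpl never.
Arguments tadd : simpl never.
Arguments topp : simpl never.
Arguments tzero : simpl never.
Arguments trho : simpl never.
Arguments trhoinv : simpl never.
Arguments tvar : simpl never.
Arguments tdiff : simpl never.
Arguments flt : simpl never.
Arguments extend : simpl never.

(** As ['X] has no inverse in the ring of operators, [coordXV] describes [mrhoinv] by an equation.
    Only the cone [s u = 1] enters, so the notion makes sense before a true sign function is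
    known. *)
Record coordinates (M : structure odg_language) (V : lmodType {poly int})
    (s : V -> int) (phi : M -> V) : Prop := Coordinates {
  coord_bij : bijective phi;
  coordD : forall x y, phi (madd x y) = phi x + phi y;
  coordN : forall x, phi (mopp x) = - phi x;
  coord0 : phi (mzero M) = 0;
  coordX : forall x, phi (mrho x) = 'X *: phi x;
  coordXV : forall x, 'X *: phi (mrhoinv x) = phi x;
  coord_lt : forall x y, mlt x y <-> s (phi y - phi x) = 1
}.

Section Coordinates.
Variables (M : structure odg_language) (V : lmodType {poly int}).
Variables (s : V -> int) (phi : M -> V).
Hypothesis co : coordinates s phi.

Lemma coord_tdiff n (v : 'I_n -> M) P t :
  phi (eval v (tdiff P t)) = P *: phi (eval v t).
Proof.
have tmulnE m u : phi (eval v (tmuln m u)) = phi (eval v u) *+ m.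
  elim: m => [|m IH]; first by rewrite [tmuln _ _]/= eval_tzero (coord0 co).
  by rewrite [tmuln _ _]/= eval_tadd (coordD co) IH mulrS.
have tmulzE m u : phi (eval v (tmulz m u)) = phi (eval v u) *~ m.
  case: m => m; first exact: tmulnE.
  by rewrite -[tmulz _ _]/(topp (tmuln m.+1 u)) eval_topp (coordN co) tmulnE.
have iterE i : phi (eval v (iter i trho t)) = 'X^i *: phi (eval v t).
  elim: i => [|i IH]; first by rewrite scale1r.
  by rewrite iterS eval_trho (coordX co) IH scalerA exprS.
rewrite /tdiff (big_morph (fun t => phi (eval v t)) (id1 := 0) (op1 := +%R)).
- rewrite -[P in RHS]coefK poly_def scaler_suml; apply: eq_bigr => i _.
  by rewrite tmulzE iterE scalerMzl -[in RHS](intz P`_i) scaler_int.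
- by move=> t1 t2; rewrite eval_tadd (coordD co).
- by rewrite eval_tzero (coord0 co).
Qed.

Lemma coord_gt0 x : mlt (mzero M) x <-> s (phi x) = 1.
Proof. by rewrite (coord_lt co) (coord0 co) subr0. Qed.

End Coordinates.

(** * From models to ordered modules and back *)

(** By the trichotomy for operators, [P *: x] has the same sign for all positive [x], so [sigma P]
    can be read off at a single positive vector. Such a vector is [e] or [- e]. *)
Lemma ordered_module_of_cone (V : lmodType {poly int}) (pos : V -> Prop) (e : V) :
    ~ pos 0 -> (forall x y, pos x -> pos y -> pos (x + y)) ->
    (forall x, x = 0 \/ pos x \/ pos (- x)) ->
    (forall x, pos x -> pos ('X *: x)) ->
    (forall P, (forall x, pos x -> pos (P *: x)) \/
      (forall x, pos x -> P *: x = 0) \/ (forall x, pos x -> pos (- (P *: x)))) ->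
    e <> 0 ->
  exists sigma s, @ordered_module V sigma s /\ forall x, s x = 1 <-> pos x.
Proof.
move=> pos0 posD pos_total posX om e0.
have posN x : pos x -> ~ pos (- x).
  by move=> px /(posD _ _ px); rewrite subrr.
pose s x : int := if `[< pos x >] then 1 else if `[< pos (- x) >] then -1 else 0.
have s_pos x : pos x -> s x = 1 by move=> px; rewrite /s asboolT.
have s_neg x : pos (- x) -> s x = -1.
  move=> px; rewrite /s asboolF ?asboolT // => /posN; exact.
have s0 : s 0 = 0 by rewrite /s oppr0 asboolF.
have sN x : s (- x) = - s x.
  have [->|[px|px]] := pos_total x; first by rewrite oppr0 s0.
    by rewrite (s_pos x) // s_neg // opprK.
  by rewrite (s_neg x) // s_pos.
have s_posE x : s x = 1 <-> pos x.
  split; last exact: s_pos.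
  by have [->|[//|px]] := pos_total x; rewrite ?s0 // s_neg.
have [x0 px0] : exists x, pos x.
  by have [//|[pe|pe]] := pos_total e; [exists e | exists (- e)].
exists (fun P => s (P *: x0)), s; split=> //; split=> //.
- move=> x; have [->|[px|px]] := pos_total x.
  + exact: Or32 s0.
  + exact: Or31 (s_pos _ px).
  + exact: Or33 (s_neg _ px).
- by move=> x; split=> [|-> //]; have [//|[/s_pos->|/s_neg->]] := pos_total x.
- by move=> x y /s_posE px /s_posE py; apply/s_pos/posD.
- move=> P.
  have sP x : pos x -> s (P *: x) = s (P *: x0).
    move=> px; have [PP|[PP|PP]] := om P.
    + by rewrite !s_pos //; exact: PP.
    + by rewrite !PP.
    + by rewrite !s_neg //; exact: PP.
  move=> x; have [->|[px|px]] := pos_total x.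
  + by rewrite scaler0 s0 mulr0.
  + by rewrite sP // (s_pos x) // mulr1.
  + by rewrite -[x in LHS]opprK scalerN sN sP // (s_neg x) // mulrN1.
- exact/s_pos/posX.
- by exists x0; exact: s_pos.
Qed.

(** The group of [M], with [rho] as the action of ['X], is transported to a module, where the
    positive elements form a cone. Axiom OM provides the trichotomy that [ordered_module_of_cone]
    asks for. *)
Lemma coordinates_of_model (M : structure odg_language) :
    models M MODAG -> (exists x, x <> mzero M) ->
  exists (V : lmodType {poly int}) sigma s (phi : M -> V),
    ordered_module sigma s /\ coordinates s phi.
Proof.
move=> modM [x0 x00].
have ax p : ODAG p -> sat (@no_var _ M) p by move=> /MODAG_ODAG/modM.
have addA : associative (@madd M).
  by move=> x y z; have /= /(_ x y z) := ax _ ODAG_add_assoc; rewrite !evalE.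
have addC : commutative (@madd M).
  by move=> x y; have /= /(_ x y) := ax _ ODAG_add_comm; rewrite !evalE.
have addr0M (x : M) : madd x (mzero M) = x.
  by have /= /(_ x) := ax _ ODAG_add_zero; rewrite !evalE.
have add0 : left_id (mzero M) (@madd M) by move=> x; rewrite addC.
have addN : left_inverse (mzero M) (@mopp M) (@madd M).
  by move=> x; rewrite addC; have /= /(_ x) := ax _ ODAG_add_opp; rewrite !evalE.
have rhoD : {morph @mrho M : x y / madd x y}.
  by move=> x y; have /= /(_ x y) := ax _ ODAG_rho_additive; rewrite !evalE.
have rhoK (x : M) : mrho (mrhoinv x) = x.
  by have /= /(_ x) := ax _ ODAG_rho_rhoinv; rewrite !evalE.
have ltD (x y z : M) : mlt x y -> mlt (madd x z) (madd y z).
  by have /= /(_ x y z) := ax _ ODAG_lt_add; rewrite !evalE.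
have lt_trans (x y z : M) : mlt x y -> mlt y z -> mlt x z.
  move=> xy yz; have /= /(_ x y z) := ax _ ODAG_lt_trans.
  by rewrite !evalE; apply.
have ltxx (x : M) : ~ mlt x x.
  by have /= /(_ x) := ax _ ODAG_lt_irrefl; rewrite !evalE.
have lt_total (x y : M) : mlt x y \/ x = y \/ mlt y x.
  by have /= /(_ x y) := ax _ ODAG_lt_total; rewrite !evalE.
have lt_rho (x y : M) : mlt x y -> mlt (mrho x) (mrho y).
  by have /= /(_ x y) := ax _ ODAG_rho_increasing; rewrite !evalE.
have [V [phi [phi_bij phiD phiX]]] :=
  lmodType_of_group addA addC add0 addN rhoD.
have phi0 : phi (mzero M) = 0.
  by apply: (addIr (phi (mzero M))); rewrite -phiD add0 add0r.
have phiN x : phi (mopp x) = - phi x.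
  by apply: (addIr (phi x)); rewrite -phiD addN phi0 addNr.
have [psi phiK psiK] := phi_bij; have phi_inj := bij_inj phi_bij.
pose pos u := mlt (mzero M) (psi u).
have rho0 : mrho (mzero M) = mzero M.
  by apply: phi_inj; rewrite phiX phi0 scaler0.
have lt_pos (x y : M) : mlt x y <-> pos (phi y - phi x).
  rewrite -phiN -phiD /pos phiK; split=> [/(ltD _ _ (mopp x))|/(ltD _ _ x)].
    by rewrite addC addN.
  by rewrite add0 -addA addN addr0M.
have pos_phi x : pos (phi x) <-> mlt (mzero M) x by rewrite /pos phiK.
have neg_phi x : pos (- phi x) <-> mlt x (mzero M).
  by rewrite lt_pos phi0 add0r.
have posD u v : pos u -> pos v -> pos (u + v).
  rewrite -(psiK u) -(psiK v) -phiD !pos_phi => pu /(ltD _ _ (psi u)).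
  by rewrite add0 addC; exact: lt_trans.
have pos_total u : u = 0 \/ pos u \/ pos (- u).
  rewrite -(psiK u) -phi0 pos_phi neg_phi.
  by case: (lt_total (mzero M) (psi u)) => [|[<-|]]; auto.
have pos0 : ~ pos 0 by rewrite -phi0 pos_phi; exact: ltxx.
have posX u : pos u -> pos ('X *: u).
  by rewrite -(psiK u) -phiX !pos_phi -{2}rho0; exact: lt_rho.
(* [coord_tdiff] is needed with an auxiliary [s] to state OM in [V], before the
   actual sign function, which depends on OM, is available. *)
have co s : (forall u, s u = 1 <-> pos u) -> coordinates s phi.
  move=> s_pos; split=> // [x|x y]; last by rewrite s_pos lt_pos.
  by rewrite -phiX rhoK.
have OM P : (forall u, pos u -> pos (P *: u)) \/
    (forall u, pos u -> P *: u = 0) \/ (forall u, pos u -> pos (- (P *: u))).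
  pose s u : int := if `[< pos u >] then 1 else 0.
  have {}co : coordinates s phi.
    by apply: co => u; rewrite /s; case: asboolP.
  have /= := modM _ (MODAG_OM P).
  have E (x : M) : extend (@no_var _ M) x = fun=> x.
    by apply/funext => -[[|k] lt_k] //; rewrite extend0.
  case=> [H|[H|H]]; [left|right; left|right; right] => u pu.
  - have := H (psi u); rewrite !evalE -!pos_phi (coord_tdiff co) evalE extend0 psiK.
    exact.
  - have := H (psi u); rewrite !evalE -!pos_phi psiK => /(_ pu)/(congr1 phi).
    by rewrite (coord_tdiff co) !evalE psiK phi0.
  - have := H (psi u); rewrite !evalE -!pos_phi -neg_phi (coord_tdiff co) evalE extend0 psiK.
    exact.
have e0 : phi x0 <> 0 by rewrite -phi0 => /phi_inj.
have [sigma [s [om s_pos]]] := ordered_module_of_cone pos0 posD pos_total posX OM e0.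
by exists V, sigma, s, phi; split=> //; exact: co.
Qed.

Lemma models_of_coordinates (M : structure odg_language)
    (V : lmodType {poly int}) sigma s (phi : M -> V) :
    ordered_module sigma s -> divisible V sigma -> coordinates s phi ->
  models M MODDAG.
Proof.
move=> om div co; have phi_inj := bij_inj (coord_bij co).
have coE := (coordD co, coordN co, coord0 co, coordX co, coord_lt co).
have X_inj u v : 'X *: u = 'X *: v -> u = v :> V.
  by apply: (scale_sigma_inj om); rewrite (sigmaX om).
(* What concerns [mrhoinv] is checked after multiplication by ['X], which is injective and keeps
   signs. *)
have rhoinvB (x y : M) : phi (mrhoinv y) - phi (mrhoinv x) = phi (mrhoinv (madd y (mopp x))).
  by apply: X_inj; rewrite scalerBr !(coordXV co) !coE.
have s_rhoinv (x : M) : s (phi (mrhoinv x)) = s (phi x).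
  by rewrite -(coordXV co x) (signZ om) (sigmaX om) mul1r.
have tdiffE := (coord_tdiff co).
(* The goals follow the constructors: the axioms of [ODAG], then OM, nontriviality and
   divisibility. *)
move=> _ [_ [_ []|P]||P] /=.
- by move=> x y z; rewrite !evalE; apply: phi_inj; rewrite !coE addrA.
- by move=> x y; rewrite !evalE; apply: phi_inj; rewrite !coE addrC.
- by move=> x; rewrite !evalE; apply: phi_inj; rewrite !coE addr0.
- by move=> x; rewrite !evalE; apply: phi_inj; rewrite !coE subrr.
- by move=> x; rewrite !evalE !coE subrr (sign0 om).
- by move=> x y z; rewrite !evalE !coE => -[]; exact: (sign_trans om).
- move=> x y; rewrite !evalE !coE.
  case: (sign_cases om (phi y - phi x)) => xy; [by left|right; left|right; right].
    by apply: phi_inj; apply/esym/eqP; rewrite -subr_eq0; apply/eqP/(sign_eq0 om).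
  by rewrite (sign_opp om) xy opprK.
- by move=> x y z; rewrite !evalE !coE opprD addrACA subrr addr0.
- by move=> x y; rewrite !evalE; apply: phi_inj; rewrite !coE scalerDr.
- by move=> x y; rewrite !evalE !coE -scalerBr (signZ om) (sigmaX om) mul1r.
- move=> x y; rewrite !evalE; apply: phi_inj; apply: X_inj.
  by rewrite !coE scalerDr !(coordXV co) coE.
- by move=> x y; rewrite !evalE !(coord_lt co) rhoinvB s_rhoinv !coE.
- by move=> x; rewrite !evalE; apply: phi_inj; rewrite coE (coordXV co).
- by move=> x; rewrite !evalE; apply/phi_inj/X_inj; rewrite (coordXV co) coE.
- case: (sigma_cases om P) => P1; [left|right; left|right; right] => x; rewrite !evalE.
  + by rewrite !(coord_gt0 co) tdiffE !evalE (signZ om) P1 mul1r.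
  + move=> _; apply: phi_inj; rewrite (coord0 co); apply/(sign_eq0 om).
    by rewrite tdiffE (signZ om) P1 mul0r.
  + rewrite (coord_gt0 co) (coord_lt co) (coord0 co) sub0r (signN om) tdiffE.
    by rewrite !evalE (signZ om) P1 mulN1r opprK.
- have [u u1] := sign_pos om; have [psi _ psiK] := coord_bij co.
  exists (psi u); rewrite !evalE => /(congr1 phi); rewrite psiK (coord0 co) => u0.
  by rewrite u0 (sign0 om) in u1.
- have [P0|/eqP/div P0] := eqVneq (sigma P) 0; [left=> x|right=> x].
    rewrite !evalE; apply: phi_inj; rewrite (coord0 co); apply/(sign_eq0 om).
    by rewrite tdiffE (signZ om) P0 mul0r.
  have [u uE] := P0 (phi x); have [psi _ psiK] := coord_bij co.
  by exists (psi u); rewrite !evalE; apply: phi_inj; rewrite tdiffE !evalE psiK.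
Qed.

(** The first alternative of the divisibility axiom would make [P] annihilate a positive vector,
    against [sigma P <> 0]. *)
Lemma divisible_of_model (M : structure odg_language)
    (V : lmodType {poly int}) sigma s (phi : M -> V) :
    ordered_module sigma s -> coordinates s phi -> models M MODDAG ->
  divisible V sigma.
Proof.
move=> om co modM P P0 y; have [psi _ psiK] := coord_bij co.
have [/= H|/= H] := modM _ (MODDAG_divisible P).
  have [u u1] := sign_pos om; have := H (psi u).
  rewrite !evalE => /(congr1 phi); rewrite (coord_tdiff co) !evalE psiK.
  move/(congr1 s); rewrite (signZ om) u1 (coord0 co) (sign0 om) mulr1.
  by move/P0.
have [x] := H (psi y); rewrite !evalE => /(congr1 phi).
by rewrite (coord_tdiff co) !evalE psiK => <-; exists (phi x).
Qed.

Lemma structure_of_module (V : lmodType {poly int}) sigma (s : V -> int) :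
    ordered_module sigma s -> divisible V sigma ->
  exists (M : structure odg_language) (phi : M -> V), coordinates s phi.
Proof.
move=> om div; have X0 : sigma 'X <> 0 by rewrite (sigmaX om).
(* Divisibility by ['X] is what provides the inverse automorphism. *)
pose rhoinv (x : V) : V := projT1 (cid (div _ X0 x)).
pose F (f : fun_sym odg_language) : ('I_(fun_arity f) -> V) -> V :=
  match f with
  | Add => fun xs : 'I_2 -> V => xs ord0 + xs ord_max
  | Opp => fun xs : 'I_1 -> V => - xs ord0
  | Zero => fun=> 0
  | Rho => fun xs : 'I_1 -> V => 'X *: xs ord0
  | RhoInv => fun xs : 'I_1 -> V => rhoinv (xs ord0)
  end.
pose R (r : rel_sym odg_language) (xs : 'I_2 -> V) : Prop :=
  s (xs ord_max - xs ord0) = 1.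
exists (@Structure odg_language V (inhabits 0) F R), (id : V -> V); split=> //.
- by exists id.
- by move=> x; rewrite /mrhoinv /= /rhoinv; case: cid.
Qed.

Section EmbeddingOfModules.
Variables (M N : structure odg_language) (V W : lmodType {poly int}).
Variables (sigma tau : {poly int} -> int) (s : V -> int) (s' : W -> int).
Variables (phi : M -> V) (chi : N -> W) (g : V -> W).
Hypotheses (omV : ordered_module sigma s) (omW : ordered_module tau s').
Hypotheses (coM : coordinates s phi) (coN : coordinates s' chi).
Hypotheses (gD : {morph g : x y / x + y}).
Hypothesis gX : forall x, g ('X *: x) = 'X *: g x.
Hypothesis gs : forall x, s' (g x) = s x.

(** The embedding is [g] read in coordinates. Preservation of signs gives both injectivity and the
    order; compatibility with [mrhoinv] follows by cancelling ['X]. *)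
Lemma embedding_of_modules : exists h : M -> N, embedding h.
Proof.
have [psi chiK psiK] := coord_bij coN; have chi_inj := bij_inj (coord_bij coN).
have gN := morphDN gD.
pose h x := psi (g (phi x)); have chi_h x : chi (h x) = g (phi x) by rewrite /h psiK.
exists h; split.
- move=> x y /(congr1 chi); rewrite !chi_h => gxy.
  apply: (bij_inj (coord_bij coM)).
  apply/eqP; rewrite -subr_eq0; apply/eqP/(sign_eq0 omV).
  by rewrite -gs gD gN gxy subrr (sign0 omW).
- case=> /= xs; apply: chi_inj; rewrite chi_h.
  + by rewrite !fun_interp_add (coordD coM) (coordD coN) gD !chi_h.
  + by rewrite !fun_interp_opp (coordN coM) (coordN coN) gN !chi_h.
  + by rewrite !fun_interp_zero (coord0 coM) (coord0 coN) morphD0.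
  + by rewrite !fun_interp_rho (coordX coM) (coordX coN) gX !chi_h.
  + rewrite !fun_interp_rhoinv; apply: (scale_sigma_inj omW (P := 'X)).
      by rewrite (sigmaX omW).
    by rewrite -gX (coordXV coM) (coordXV coN) chi_h.
- case=> /= xs; rewrite !rel_interp_lt (coord_lt coM) (coord_lt coN) !chi_h.
  by rewrite -gN -gD gs.
Qed.

End EmbeddingOfModules.

Lemma moddag_of_module (V : lmodType {poly int}) sigma (s : V -> int)
    (om : ordered_module sigma s) :
  exists (N : structure odg_language) (chi : N -> localization om),
    models N MODDAG /\ coordinates (@loc_sign _ _ _ om) chi.
Proof.
have om' := localization_ordered om; have div := @localization_divisible _ _ _ om.
have [N [chi co]] := structure_of_module om' div.
by exists N, chi; split=> //; exact: models_of_coordinates om' div co.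
Qed.

Lemma int_ordered_module :
  exists (V : lmodType {poly int}) sigma (s : V -> int), ordered_module sigma s.
Proof.
have idD : {morph (id : int -> int) : x y / x + y} by [].
pose V : lmodType {poly int} := poly_module idD.
(* With the identity as [rho], an operator multiplies by the sum of its coefficients, whose sign
   decides OM. *)
have scaleE P (x : V) : P *: x = (x : int) * P.[1] :> int.
  rewrite horner_coef mulr_sumr; apply: eq_bigr => i _.
  rewrite expr1n mulr1 -mulrzz; congr (_ *~ _).
  by elim: (nat_of_ord i).
have [||||||sigma [s [om _]]] :=
    @ordered_module_of_cone V (fun x => 0 < (x : int)) (1 : int).
- by [].
- by move=> x y; exact: addr_gt0.
- move=> x; case: (ltrgtP (x : int) 0) => x0; [right; right|right; left|left] => //.
  by rewrite oppr_gt0.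
- by move=> x x0; rewrite scaleE hornerX mulr1.
- move=> P; case: (ltrgtP P.[1] 0) => P1; [right; right|left|right; left] => x x0.
  + by rewrite oppr_gt0 scaleE pmulr_rlt0.
  + by rewrite scaleE mulr_gt0.
  + by apply: etrans (scaleE P x) _; rewrite P1 mulr0.
- by [].
by exists V, sigma, s.
Qed.

(** * The model companion *)

Lemma modag_embeds_moddag : models_embed MODAG MODDAG.
Proof.
move=> M modM; case: (pselect (exists x, x <> mzero M)) => [nt|triv].
  have [V [sigma [s [phi [om co]]]]] := coordinates_of_model modM nt.
  have [N [chi [modN coN]]] := moddag_of_module om.
  have [h hE] : exists h : M -> N, embedding h.
    apply: (embedding_of_modules om (localization_ordered om) co coN
      (loc_embedD om)).
    - by move=> x; rewrite /loc_embed fracZ.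
    - by move=> x; rewrite /loc_embed loc_signE.
  by exists N, h.
have [V [sigma [s om]]] := int_ordered_module.
have [N [chi [modN coN]]] := moddag_of_module om.
have chi_inj := bij_inj (coord_bij coN); have om' := localization_ordered om.
have M0 x : x = mzero M by apply: contrapT => x0; apply: triv; exists x.
exists N, (fun=> mzero N); split=> //; split.
- by move=> x y _; rewrite (M0 x) (M0 y).
- case=> xs; apply: chi_inj; rewrite (coord0 coN).
  + by rewrite fun_interp_add (coordD coN) (coord0 coN) addr0.
  + by rewrite fun_interp_opp (coordN coN) (coord0 coN) oppr0.
  + by rewrite fun_interp_zero (coord0 coN).
  + by rewrite fun_interp_rho (coordX coN) (coord0 coN) scaler0.
  + rewrite fun_interp_rhoinv; apply: (scale_sigma_inj om' (P := 'X)).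
      by rewrite (sigmaX om').
    by rewrite (coordXV coN) (coord0 coN) scaler0.
(* Both sides of the equivalence are false, by irreflexivity in [M] and because 0 has sign 0 in the
   target. *)
- case=> xs; rewrite !rel_interp_lt (M0 (xs ord0)) (M0 (xs ord_max)).
  rewrite (coord_lt coN) subrr (sign0 om'); split=> // lt00.
  have /= /(_ (mzero M)) := modM _ (MODAG_ODAG ODAG_lt_irrefl).
  by rewrite !evalE.
Qed.

(** * Formulas decided by the signs of linear forms *)

(** The power of ['X] clears the occurrences of [rho^-1], one factor for each nested one; since ['X]
    has sign 1, signs are not affected. The form depends on the term alone, not on the model. *)
Lemma term_form n (t : term odg_language n) :
  exists k (f : linear_form n), forall (M : structure odg_language)
    (V : lmodType {poly int}) (s : V -> int) (phi : M -> V),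
    coordinates s phi -> forall v : 'I_n -> M,
    'X^k *: phi (eval v t) = lin_eval f (phi \o v).
Proof.
elim: t => [i|[] /= ts IH].
- exists 0, [ffun j => (j == i)%:R] => M V s phi co v.
  rewrite scale1r /lin_eval (bigD1 i) //= ffunE eqxx scale1r big1 ?addr0 // => j.
  by rewrite ffunE => /negPf ->; rewrite scale0r.
- have [k [f fE]] := IH ord0; have [l [g gE]] := IH ord_max.
  exists (k + l)%N, (form_comb 'X^l f 'X^k g) => M V s phi co v.
  rewrite lin_eval_comb -(fE _ _ _ _ co) -(gE _ _ _ _ co) !scalerA -!exprD.
  rewrite [eval v _]fun_interp_add (coordD co) scalerDr.
  by rewrite [(l + k)%N]addnC.
- have [k [f fE]] := IH ord0.
  (* Coefficient 0 on the second form turns [form_comb] into a scalar multiple. *)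
  exists k, (form_comb (-1) f 0 f) => M V s phi co v.
  rewrite lin_eval_comb -(fE _ _ _ _ co) scale0r addr0 scaleN1r.
  by rewrite [eval v _]fun_interp_opp (coordN co) scalerN.
- exists 0, [ffun=> 0] => M V s phi co v.
  rewrite [eval v _]fun_interp_zero (coord0 co) scaler0.
  by rewrite /lin_eval big1 // => i _; rewrite ffunE scale0r.
- have [k [f fE]] := IH ord0.
  exists k, (form_comb 'X f 0 f) => M V s phi co v.
  rewrite lin_eval_comb -(fE _ _ _ _ co) scale0r addr0 !scalerA.
  by rewrite [eval v _]fun_interp_rho (coordX co) scalerA mulrC.
- have [k [f fE]] := IH ord0.
  exists k.+1, f => M V s phi co v.
  rewrite -(fE _ _ _ _ co) [eval v _]fun_interp_rhoinv exprSr -scalerA.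
  by rewrite (coordXV co).
Qed.

(** Here [sigma] is a parameter, so that two models can be required to share it. *)
Record presentation (sigma : {poly int} -> int) (M : structure odg_language) :=
  Presentation {
    pmod : lmodType {poly int};
    psign : pmod -> int;
    pcoord : M -> pmod;
    pordered : ordered_module sigma psign;
    pdivisible : divisible pmod sigma;
    pcoordinates : coordinates psign pcoord
  }.

Definition assignments_agree sigma (M N : structure odg_language)
    (X : presentation sigma M) (Y : presentation sigma N) n
    (F : seq (linear_form n)) (v : 'I_n -> M) (w : 'I_n -> N) :=
  signs_agree (@psign _ _ X) (@psign _ _ Y) F (@pcoord _ _ X \o v) (@pcoord _ _ Y \o w).

(** Crossing the two powers of ['X] gives a form equal to ['X^(k + l)] times the difference of the
    terms. Its sign decides both equality and order. *)
Lemma atomic_form n (t u : term odg_language n) :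
  exists f : linear_form n, forall sigma M (X : presentation sigma M) v,
    psign (pcoord X (eval v u) - pcoord X (eval v t)) =
    psign (lin_eval f (@pcoord _ _ X \o v)).
Proof.
have [k [f fE]] := term_form t; have [l [g gE]] := term_form u.
exists (form_comb 'X^k g (- 'X^l) f) => sigma M X v.
have co := pcoordinates X; have om := pordered X.
rewrite lin_eval_comb -(fE _ _ _ _ co) -(gE _ _ _ _ co) scaleNr !scalerA -!exprD.
by rewrite addnC -scalerBr (signZ om) (sigmaXn om) mul1r.
Qed.

(** Induction on the formula. One implication suffices, as agreement is symmetric: negation and the
    premise of an implication use it with the models exchanged. Quantifiers pass from [F] to
    [eliminate F]. *)
Lemma sat_determined n (p : formula odg_language n) :
  exists F : seq (linear_form n), forall sigma M N
    (X : presentation sigma M) (Y : presentation sigma N) v w,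
    assignments_agree X Y F v w -> sat v p -> sat w p.
Proof.
have agree_sym m (F : seq (linear_form m)) sigma M N
    (X : presentation sigma M) (Y : presentation sigma N) v w :
    assignments_agree X Y F v w -> assignments_agree Y X F w v.
  by move=> vw f /vw.
have agree_cat m (F G : seq (linear_form m)) sigma M N
    (X : presentation sigma M) (Y : presentation sigma N) v w :
    assignments_agree X Y (F ++ G) v w ->
    assignments_agree X Y F v w /\ assignments_agree X Y G v w.
  by move=> vw; split=> f fF; apply: vw; rewrite mem_cat fF ?orbT.
have agree_extend m (F : seq (linear_form m.+1)) sigma M N
    (X : presentation sigma M) (Y : presentation sigma N) v w (a : M) :
    assignments_agree X Y (eliminate F) v w ->
    exists b, assignments_agree X Y F (extend v a) (extend w b).
  move=> /(back_and_forth (pordered X) (pordered Y) (@pdivisible _ _ X) (@pdivisible _ _ Y)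
    (pcoord X a))[b bE].
  have [psi _ psiK] := coord_bij (pcoordinates Y); exists (psi b) => f /bE.
  have evE M' (Z : presentation sigma M') (z : 'I_m -> M') c :
      lin_eval f (@pcoord _ _ Z \o extend z c) =
      f ord0 *: pcoord Z c + lin_eval (form_tail f) (@pcoord _ _ Z \o z).
    rewrite /lin_eval big_ord_recl /= extend_ord0; congr (_ + _).
    by apply: eq_bigr => i _; rewrite ffunE /= extend_lift.
  by rewrite !evE psiK.
elim: p => {n} [n|n t u|n [] ts|n p [F FE]|n p [F FE] q [G GE]|n p [F FE] q [G GE]
  |n p [F FE] q [G GE]|n p [F FE]|n p [F FE]] /=.
- by exists [::].
- have [f fE] := atomic_form t u; exists [:: f] => sigma M N X Y v w.
  move=> /(_ f (mem_head _ _)); rewrite -!fE => vw tu; move: vw.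
  rewrite tu subrr (sign0 (pordered X)) => /esym/(sign_eq0 (pordered Y))/eqP.
  rewrite subr_eq0 => /eqP/esym; exact: (bij_inj (coord_bij (pcoordinates Y))).
- have [f fE] := atomic_form (ts ord0) (ts ord_max).
  exists [:: f] => sigma M N X Y v w /(_ f (mem_head _ _)).
  rewrite -!fE !rel_interp_lt => vw.
  by rewrite (coord_lt (pcoordinates X)) (coord_lt (pcoordinates Y)) vw.
- by exists F => sigma M N X Y v w /agree_sym /FE H nv /H.
- exists (F ++ G) => sigma M N X Y v w /agree_cat[/FE f /GE g] [vp vq].
  by split; [exact: f|exact: g].
- exists (F ++ G) => sigma M N X Y v w /agree_cat[/FE f /GE g] [vp|vq].
    by left; exact: f.
  by right; exact: g.
- exists (F ++ G) => sigma M N X Y v w /agree_cat[/agree_sym/FE f /GE g] pq.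
  by move=> /f/pq/g.
(* For a universal formula, an element of [N] is matched back in [M]. *)
- exists (eliminate F) => sigma M N X Y v w /agree_sym vw vp b.
  have [a /agree_sym/FE] := agree_extend _ _ _ _ _ _ _ _ _ b vw; apply.
  exact: vp.
- exists (eliminate F) => sigma M N X Y v w vw [a va].
  have [b /FE ab] := agree_extend _ _ _ _ _ _ _ _ _ a vw.
  by exists b; exact: ab.
Qed.

Lemma presentation_of_model (M : structure odg_language) :
  models M MODDAG -> exists sigma, inhabited (presentation sigma M).
Proof.
move=> modM.
have modM' : models M MODAG by move=> p /MODDAG_MODAG/modM.
have [|V [sigma [s [phi [om co]]]]] := coordinates_of_model modM'.
  by have /= [x] := modM _ MODDAG_nontrivial; rewrite !evalE; exists x.
exists sigma; split.
exact: (Presentation om (divisible_of_model om co modM) co).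
Qed.

Lemma embedding_eval (M N : structure odg_language) (h : M -> N) n
    (v : 'I_n -> M) (t : term odg_language n) :
  embedding h -> h (eval v t) = eval (h \o v) t.
Proof.
case=> _ hf _; elim: t => // f ts IH; rewrite [eval v _]/= hf.
by congr fun_interp; apply/funext => i; exact: IH.
Qed.

(** An embedding preserves the signs of elements, which forces the two models to have the same
    [sigma]. Then all linear forms have equal signs at [v] and at its image, and [sat_determined]
    applies in both directions. *)
Lemma moddag_model_complete : model_complete MODDAG.
Proof.
move=> M N h modM modN emb.
have [sigma [X]] := presentation_of_model modM.
have [tau [Y]] := presentation_of_model modN.
have omX := pordered X; have omY := pordered Y.
have coX := pcoordinates X; have coY := pcoordinates Y.
have h0 : h (mzero M) = mzero N.
  by case: emb => _ hf _; rewrite /mzero hf fun_interp_zero.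
have h_lt x y : mlt x y <-> mlt (h x) (h y).
  by case: emb => _ _ hr; rewrite /mlt hr rel_interp_lt.
have h_sign x : psign (pcoord X x) = psign (pcoord Y (h x)).
  have := h_lt (mzero M) x; rewrite h0 (coord_gt0 coX) (coord_gt0 coY).
  have := h_lt x (mzero M); rewrite h0 (coord_lt coX) (coord_lt coY).
  rewrite (coord0 coX) (coord0 coY) !sub0r (signN omX) (signN omY).
  (* Unequal signs would contradict the preservation of [0 < x] or of [x < 0]. *)
  case: (sign_cases omX (pcoord X x)) => ->;
    case: (sign_cases omY (pcoord Y (h x))) => -> [A B] [C D] //;
    by first [have := A erefl | have := B erefl | have := C erefl | have := D erefl].
have h_tdiff P x : exists2 z, pcoord X z = P *: pcoord X x
    & pcoord Y (h z) = P *: pcoord Y (h x).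
  pose t : term odg_language 1 := tdiff P (Var ord0).
  exists (eval (fun=> x) t); first by rewrite (coord_tdiff coX).
  by rewrite embedding_eval // (coord_tdiff coY).
(* The sign of an operator is visible on a positive element of [M], whose image is positive in
   [N]. *)
have sigma_tau : sigma = tau.
  apply/funext => P; have [u u1] := sign_pos omX.
  have [psi _ psiK] := coord_bij coX; have hu := h_sign (psi u).
  have [z zX zY] := h_tdiff P (psi u); have := h_sign z.
  by rewrite zX zY (signZ omX) (signZ omY) -hu psiK u1 !mulr1.
rewrite -{}sigma_tau in Y omY coY h_sign h_tdiff *.
have agree n (F : seq (linear_form n)) v : assignments_agree X Y F v (h \o v).
  move=> f _.
  (* Each linear form is the value of a term, and embeddings commute with the evaluation of
     terms. *)
  pose t : term odg_language n := \big[tadd/tzero]_i tdiff (f i) (Var i).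
  have tE K (Z : presentation sigma K) (w : 'I_n -> K) :
      pcoord Z (eval w t) = lin_eval f (@pcoord _ _ Z \o w).
    have coZ := pcoordinates Z.
    rewrite (big_morph (fun t => pcoord Z (eval w t)) (id1 := 0) (op1 := +%R)).
    - by apply: eq_bigr => i _; rewrite (coord_tdiff coZ).
    - by move=> t1 t2; rewrite eval_tadd (coordD coZ).
    - by rewrite eval_tzero (coord0 coZ).
  by rewrite -!tE -embedding_eval.
move=> n v p; have [F FE] := sat_determined p; split.
  exact: (FE _ _ _ _ _ _ _ (agree n F v)).
by apply: (FE _ _ _ Y X) => f fF; exact: (esym (agree n F v f fF)).
Qed.

Theorem theorem2p6 : model_companion MODAG MODDAG.
Proof.
split; [exact: modag_embeds_moddag| |exact: moddag_model_complete].
(* [MODDAG] extends [MODAG], so the identity embeds its models. *)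
by move=> M modM; exists M, id; split=> [p /MODDAG_MODAG/modM|]; last split.
Qed.
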